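(* Let $\mathbb{S}^{2,4}=\{x\in\mathbb{R}^{3,4}: g(x,x)=1\}$ with normal vector $\mathbf n(x)=x$. The Nijenhuis tensor $N$ of the almost complex Cayley structure $J$ on $\mathbb{S}^{2,4}$ has the form $$N(X,Y)=-8\,\mathbf n\times(X\times Y)=-8\,J(X\times Y)$$ for all tangent vectors $X,Y$ to $\mathbb{S}^{2,4}$ at a common point.
   Context: The split Cayley algebra $\mathbf{Ca}'$ is the real vector space of elements $a+be$ with $a,b$ quaternions, with multiplication $(a+be)(c+de)=(ac+\overline d\,b)+(da+b\overline c)e$. With $e_1,e_2,e_3$ the standard quaternion units ($e_1e_2=e_3$), put $e_4=e$, $e_5=e_1e$, $e_6=e_2e$, $e_7=e_3e$. Conjugation is $\overline x=x_0-x_1e_1-\dots-x_7e_7$, and $\langle\cdot,\cdot\rangle$ is the scalar product with quadratic form $x\overline x=x_0^2+x_1^2+x_2^2+x_3^2-x_4^2-x_5^2-x_6^2-x_7^2$. The space $\mathbb{R}^{3,4}=\Im(\mathbf{Ca}')=\mathrm{span}(e_1,\dots,e_7)$ carries the restriction $g$ of $\langle\cdot,\cdot\rangle$, of signature $(3,4)$. The vector cross product is $X\times Y=\Im(XY)=XY+g(X,Y)$. The almost complex Cayley structure is $J_x:T_x\mathbb{S}^{2,4}\to T_x\mathbb{S}^{2,4}$, $J_x(Y)=\mathbf n(x)\times Y$; the expression $J(X\times Y)$ means $\mathbf n\times(X\times Y)$ (the normal component of $X\times Y$ is annihilated by $\mathbf n\times$). The Nijenhuis tensor is $$N(X,Y)=2\big([JX,JY]-[X,Y]-J[JX,Y]-J[X,JY]\big)$$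 for vector fields $X,Y$ on $\mathbb{S}^{2,4}$. *)

(* Defs.v *)
From HB Require Import structures.
From mathcomp Require Import all_boot all_order all_algebra.
From mathcomp Require Import all_classical all_reals all_analysis.
From mathcomp Require Import ring.

Set Implicit Arguments.
Unset Strict Implicit.
Unset Printing Implicit Defensive.

Import Order.TTheory GRing.Theory Num.Theory.
Import numFieldNormedType.Exports.

Local Open Scope classical_set_scope.
Local Open Scope ring_scope.

Section SplitCayley.
Variable R : realType.

(* The row (q0, q1, q2, q3) is the quaternion q0 + q1 e1 + q2 e2 + q3 e3,
   where e1 e2 = e3. *)
Definition quat := 'rV[R]_4.

Definition qmul (p q : quat) : quat :=
  \row_(i < 4)
   [:: p 0 0 * q 0 0 - p 0 1 * q 0 1 - p 0 2 * q 0 2 - p 0 3 * q 0 3;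
       p 0 0 * q 0 1 + p 0 1 * q 0 0 + p 0 2 * q 0 3 - p 0 3 * q 0 2;
       p 0 0 * q 0 2 - p 0 1 * q 0 3 + p 0 2 * q 0 0 + p 0 3 * q 0 1;
       p 0 0 * q 0 3 + p 0 1 * q 0 2 - p 0 2 * q 0 1 + p 0 3 * q 0 0]`_i.

Definition qconj (q : quat) : quat :=
  \row_(i < 4) [:: q 0 0; - q 0 1; - q 0 2; - q 0 3]`_i.

(* The pair (a, b) is a + b e. *)
Definition cayley := (quat * quat)%type.

Definition cmul (x y : cayley) : cayley :=
  (qmul x.1 y.1 + qmul (qconj y.2) x.2,
   qmul y.2 x.1 + qmul x.2 (qconj y.1)).

(* R^{3,4} = span(e1, ..., e7); the coefficient of e_k is the entry of
   index k - 1. *)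
Definition imag := 'rV[R]_7.

Definition cayley_of_imag (X : imag) : cayley :=
  (\row_(i < 4) [:: 0; X 0 0; X 0 1; X 0 2]`_i,
   \row_(i < 4) [:: X 0 3; X 0 4; X 0 5; X 0 6]`_i).

Definition ImCa (x : cayley) : imag :=
  \row_(i < 7) [:: x.1 0 1; x.1 0 2; x.1 0 3;
                   x.2 0 0; x.2 0 1; x.2 0 2; x.2 0 3]`_i.

Definition g (X Y : imag) : R :=
  \sum_(i < 7) (if (i < 3)%N then X 0 i * Y 0 i else - (X 0 i * Y 0 i)).

Definition cross (X Y : imag) : imag :=
  ImCa (cmul (cayley_of_imag X) (cayley_of_imag Y)).

Definition S24 : set imag := [set x | g x x = 1].

Definition unit_normal (x : imag) : imag := x.

(* T_x S^{2,4} is the kernel of the differential u |-> 2 g(x, u) at x of the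
   defining function g(x, x). *)
Definition tangent (x : imag) : set imag := [set u | g (unit_normal x) u = 0].

Definition J (x Y : imag) : imag := cross (unit_normal x) Y.

Definition iter_derive (f : imag -> imag) (s : seq imag) : imag -> imag :=
  foldr (fun v h => fun x => 'D_v h x) f s.

(* All iterated directional derivatives are differentiable on U; for an open
   set U this is the C^infinity property. *)
Definition smooth_in (U : set imag) (f : imag -> imag) :=
  forall s x, U x -> differentiable (iter_derive f s) x.

(* Smoothness on an arbitrary subset A: local smooth extendability. *)
Definition smooth_on (A : set imag) (f : imag -> imag) :=
  forall p, A p -> exists U F, [/\ open U, U p, smooth_in U F &
    forall y, U y -> A y -> F y = f y].

(* Only the values on S^{2,4} of such an X are meaningful. *)
Definition vector_field (X : imag -> imag) :=
  smooth_on S24 X /\ forall x, S24 x -> tangent x (X x).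

Lemma gC (p q : imag) : g p q = g q p.
Proof. by apply: eq_bigr => i _; case: ifP => _; rewrite mulrC. Qed.

Lemma gD (p y z : imag) : g p (y + z) = g p y + g p z.
Proof.
rewrite /g -big_split; apply: eq_bigr => i _ /=; rewrite mxE.
by case: ifP => _; ring.
Qed.

Lemma gZ (p : imag) k z : g p (k *: z) = k * g p z.
Proof.
rewrite /g mulr_sumr; apply: eq_bigr => i _; rewrite mxE.
by case: ifP => _; ring.
Qed.

Lemma differentiable_g (p y : imag) : differentiable (g p) y.
Proof.
have -> : g p = \sum_(i < 7)
    ((if (i < 3)%N then p 0 i else - p 0 i) \*: (fun y : imag => y 0 i)).
  apply/funext => z; rewrite fct_sumE; apply: eq_bigr => i _ /=.
  by case: ifP => _; rewrite /GRing.scale /= ?mulNr.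
by apply: differentiable_sum => i; apply/differentiableZ/differentiable_coord.
Qed.

Lemma is_derive_g (p y v : imag) : is_derive y v (g p) (g p v).
Proof.
apply: DeriveDef; first exact/diff_derivable/differentiable_g.
rewrite /derive; apply/cvg_lim; first exact: norm_hausdorff.
apply: cvg_near_cst; near=> h.
have h0 : h != 0 by near: h; exact: nbhs_dnbhs_neq.
by rewrite /= gD gZ addrK /GRing.scale /= mulKf.
Unshelve. all: by end_near. Qed.

Inductive poly_fun : (imag -> R) -> Prop :=
| poly_cst c : poly_fun (cst c)
| poly_g p : poly_fun (g p)
| poly_add f h of poly_fun f & poly_fun h : poly_fun (f + h)
| poly_mul f h of poly_fun f & poly_fun h : poly_fun (f * h).

Lemma differentiable_poly f y : poly_fun f -> differentiable f y.
Proof.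
elim=> [c|p|{}f h _ df _ dh|{}f h _ df _ dh].
- exact: differentiable_cst.
- exact: differentiable_g.
- exact: differentiableD.
- exact: differentiableM.
Qed.

Lemma derive_poly f v : poly_fun f -> poly_fun (fun y => 'D_v f y).
Proof.
elim=> [c|p|{}f h pf df ph dh|{}f h pf df ph dh].
- rewrite (_ : (fun y => _) = cst 0); first exact: poly_cst.
  by apply/funext => y; rewrite derive_cst.
- rewrite (_ : (fun y => _) = cst (g p v)); first exact: poly_cst.
  by apply/funext => y; have [] := is_derive_g p y v.
- rewrite (_ : (fun y => _) = (fun y => 'D_v f y) + (fun y => 'D_v h y)).
    exact: poly_add.
  by apply/funext => y; rewrite deriveD//; exact/diff_derivable/differentiable_poly.
- rewrite (_ : (fun y => _) =
      f * (fun y => 'D_v h y) + h * (fun y => 'D_v f y)).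
    by apply: poly_add; exact: poly_mul.
  by apply/funext => y; rewrite deriveM//; exact/diff_derivable/differentiable_poly.
Qed.

Definition poly_field (f : 'I_7 -> imag -> R) : imag -> imag :=
  \sum_(i < 7) (fun y => f i y *: delta_mx 0 i).

Lemma smooth_poly_field f : (forall i, poly_fun (f i)) ->
  smooth_in setT (poly_field f).
Proof.
have dZ (h : imag -> R) (w : imag) y : poly_fun h ->
    differentiable (fun y => h y *: w) y.
  by move=> ph; apply/differentiableZl/differentiable_poly.
move=> pf s; suff [h ph ->] : exists2 h, (forall i, poly_fun (h i)) &
    iter_derive (poly_field f) s = poly_field h.
  by move=> y _; apply: differentiable_sum => i; exact: dZ.
elim: s => [|v s [h ph IH]]; first by exists f.
exists (fun i y => 'D_v (h i) y) => [i|]; first exact: derive_poly.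
rewrite /= IH; apply/funext => y.
rewrite derive_sum => [|i]; last exact/diff_derivable/dZ.
rewrite /poly_field fct_sumE; apply: eq_bigr => i _.
rewrite deriveE ?diffZl; [|exact: differentiable_poly|exact: dZ].
by rewrite -deriveE //; exact: differentiable_poly.
Qed.

(* Every tangent vector of S^{2,4} is a value of some vector field. *)
Lemma tangent_extends (x u : imag) : S24 x -> tangent x u ->
  exists X, vector_field X /\ X x = u.
Proof.
move=> _ xu.
pose e (i : 'I_7) : imag := (if (i < 3)%N then 1 else -1) *: delta_mx 0 i.
have ge i y : g (e i) y = y 0 i.
  rewrite /g (bigD1 i) //= big1 => [|j ji]; rewrite !mxE !eqxx ?(negPf ji) /=.
    by case: (i < 3)%N; ring.
  by case: (j < 3)%N; ring.
pose f i : imag -> R := cst (u 0 i) + cst (-1) * (g u * g (e i)).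
have fE y : poly_field f y = u - g u y *: y.
  rewrite /poly_field fct_sumE; apply/rowP => k.
  rewrite summxE (bigD1 k) //= big1 => [|j jk]; rewrite !mxE !eqxx /=.
    by rewrite addr0 mulr1 /f !fctE ge mulN1r.
  by rewrite eq_sym (negPf jk) mulr0.
exists (poly_field f); split; last by rewrite fE gC xu scale0r subr0.
split=> [p _|y /= Sy].
  exists setT, (poly_field f); split=> //; first exact: openT.
  apply: smooth_poly_field => i; apply: poly_add; first exact: poly_cst.
  by apply: poly_mul; [exact: poly_cst|apply: poly_mul; exact: poly_g].
by rewrite /tangent /= /unit_normal fE -scaleNr gD gZ Sy mulr1 gC subrr.
Qed.

(* The retraction of the open cone g(y, y) > 0 onto S^{2,4}. *)
Definition radial (y : imag) : imag := (Num.sqrt (g y y))^-1 *: y.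

Definition ambient_bracket (F G : imag -> imag) (x : imag) : imag :=
  'D_(F x) G x - 'D_(G x) F x.

(* The ambient bracket of local extensions of vector fields X, Y tangent to a
   submanifold restricts on it to [X, Y], whatever the extensions; those used
   here are constant along the rays, so that the result depends only on the
   values of X and Y on S^{2,4}. *)
Definition lie_bracket (X Y : imag -> imag) : imag -> imag :=
  ambient_bracket (X \o radial) (Y \o radial).

Definition Jfield (X : imag -> imag) : imag -> imag := fun x => J x (X x).

Definition nijenhuis (X Y : imag -> imag) (x : imag) : imag :=
  2 *: (lie_bracket (Jfield X) (Jfield Y) x - lie_bracket X Y x
        - J x (lie_bracket (Jfield X) Y x) - J x (lie_bracket X (Jfield Y) x)).

End SplitCayley.

(* Main.v *)
Require Import Defs.
From HB Require Import structures.
From mathcomp Require Import all_boot all_order all_algebra.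
From mathcomp Require Import all_classical all_reals all_analysis.
From mathcomp Require Import ring.
Import Order.TTheory GRing.Theory Num.Theory.
Import numFieldNormedType.Exports.
Local Open Scope classical_set_scope.
Local Open Scope ring_scope.
Set Implicit Arguments.
Unset Strict Implicit.
Unset Printing Implicit Defensive.

(** Write u = X x, v = Y x, and let D_w denote the derivative at x of the
    extensions of X and Y that are constant along the rays. The radial
    retraction has derivative w in a tangent direction w, so the product rule
    for the bilinear map [cross] gives ([derive_Jfield])
      D_w (JX) = w * X + J (D_w X),
    where * is the cross product. Substituting this in the four brackets of
    the Nijenhuis tensor, the derivatives in the directions J u and J v cancel
    and there remains
      N / 2 = (J u * v - J v * u) - 2 J (u * v)
              - (D_u Y + J J D_u Y) + (D_v X + J J D_v X).
    For every w one has w + J J w = g(x, w) x ([J_J]), and differentiating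
    g(n, Y) = 0 gives g(x, D_u Y) = - g(u, v), and likewise
    g(x, D_v X) = - g(v, u) ([g_derive_vector_field]). Hence the last two
    brackets cancel by the symmetry of g: the derivatives of the fields drop
    out and N depends on u and v only. What is left is algebra: the failure of
    associativity of the cross product is controlled by the metric
    ([cross_cross]), which for tangent u, v yields
    J u * v - J v * u = - 2 J (u * v) ([cross_J_antisym]), so N / 2 is
    - 4 J (u * v).

    The derivatives make sense because near x the extension of X is F composed
    with the radial retraction, for any local smooth extension F of X
    ([derivable_vector_field]). *)

(** * Calculus of bilinear maps *)

Section BilinearCalculus.
Variable K : numFieldType.

(** A bilinear map out of finite-dimensional spaces is polynomial in the
    coordinates. *)
Lemma bilinear_rV_continuous m n (W : normedModType K)
    (b : {bilinear 'rV[K]_m -> 'rV[K]_n -> W}) :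
  continuous (fun p => b p.1 p.2).
Proof.
have -> : (fun p => b p.1 p.2) = (fun p : 'rV[K]_m * 'rV[K]_n =>
    \sum_(i < m) \sum_(j < n)
      p.1 0 i *: (p.2 0 j *: b (delta_mx 0 i) (delta_mx 0 j))).
  apply/funext => -[u v] /=.
  rewrite [in LHS](row_sum_delta u) linear_sumlz; apply: eq_bigr => i _.
  rewrite linearZl_LR [in LHS](row_sum_delta v) linear_sumr scaler_sumr.
  by apply: eq_bigr => j _; rewrite linearZr_LR.
apply: continuous_big => [|i _]; first exact: add_continuous.
apply: continuous_big => [|j _ p]; first exact: add_continuous.
apply: cvgZ.
  by apply: (@continuous_comp _ _ _ fst (fun u : 'rV[K]_m => u 0 i));
    [exact: cvg_fst|exact: coord_continuous].
apply: cvgZr_tmp.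
by apply: (@continuous_comp _ _ _ snd (fun u : 'rV[K]_n => u 0 j));
  [exact: cvg_snd|exact: coord_continuous].
Qed.

Variables U V1 V2 W : normedModType K.

Lemma differentiable_bilinear (b : {bilinear V1 -> V2 -> W})
    (f : U -> V1) (h : U -> V2) x : continuous (fun p => b p.1 p.2) ->
  differentiable f x -> differentiable h x ->
  differentiable (fun y => b (f y) (h y)) x.
Proof.
move=> bc df dh.
apply: (@differentiable_comp _ _ _ _ (fun y => (f y, h y))
  (fun p => b p.1 p.2)).
  exact: differentiable_pair.
exact: differentiable_bilin.
Qed.

(** The product rule. It asks only for directional derivatives, as these, and
    not differentials, transfer between functions that agree near a point. *)
Lemma is_derive_bilinear (b : {bilinear V1 -> V2 -> W})
    (f : U -> V1) (h : U -> V2) x v df dh : continuous (fun p => b p.1 p.2) ->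
  is_derive x v f df -> is_derive x v h dh ->
  is_derive x v (fun y => b (f y) (h y)) (b df (h x) + b (f x) dh).
Proof.
move=> bc [fv <-] [hv <-].
suff lim_b : (fun t => t^-1 *: (b (f (t *: v + x)) (h (t *: v + x)) -
    b (f x) (h x))) @ 0^' --> b ('D_v f x) (h x) + b (f x) ('D_v h x).
  apply: DeriveDef; last exact: cvg_lim lim_b.
  by apply/cvg_ex; eexists; exact: lim_b.
have -> : (fun t => t^-1 *: (b (f (t *: v + x)) (h (t *: v + x)) -
    b (f x) (h x))) =
  (fun t => b (t^-1 *: (f (t *: v + x) - f x)) (h x) +
            b (f (t *: v + x)) (t^-1 *: (h (t *: v + x) - h x))).
  apply/funext => t.
  rewrite linearZl_LR linearZr_LR -scalerDr linearBl linearBr /=.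
  by congr (_ *: _); rewrite [RHS]addrC addrA subrK.
apply: cvgD.
  by apply: (cvg_comp2 fv (cvg_cst _) (bc (_, _))).
apply: cvg_comp2 _ hv (bc (_, _)).
(* Derivability in the direction v gives continuity along the line x + t v. *)
suff : {for 0, continuous (fun t : K => f (t *: v + x))}.
  by move=> /continuous_withinNx; rewrite scale0r add0r.
exact/differentiable_continuous/derivable1_diffP/(derivable1P _ _ _).1.
Qed.

Lemma scale_is_bilinear :
  bilinear_for (GRing.Scale.Law.clone _ _ *:%R _)
    (GRing.Scale.Law.clone _ _ *:%R _) (@GRing.scale K U : K -> U -> U).
Proof.
by split=> [u|k] a x y /=; rewrite (scalerDl, scalerDr) !scalerA // mulrC.
Qed.

HB.instance Definition _ :=
  bilinear_isBilinear.Build K K U U _ _ (@GRing.scale K U) scale_is_bilinear.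

End BilinearCalculus.

Section CayleyStructure.
Variable R : realType.
Implicit Types x u v w : imag R.

(** * Algebra of the cross product *)

Lemma imag_eqP u v : u 0 0 = v 0 0 -> u 0 1 = v 0 1 -> u 0 2 = v 0 2 ->
  u 0 3 = v 0 3 -> u 0 4 = v 0 4 -> u 0 5 = v 0 5 -> u 0 6 = v 0 6 -> u = v.
Proof.
move=> h0 h1 h2 h3 h4 h5 h6; apply/rowP => -[[|[|[|[|[|[|[|k]]]]]]] lt_k7] //.
- by move: h0; congr (u _ _ = v _ _); apply/val_inj.
- by move: h1; congr (u _ _ = v _ _); apply/val_inj.
- by move: h2; congr (u _ _ = v _ _); apply/val_inj.
- by move: h3; congr (u _ _ = v _ _); apply/val_inj.
- by move: h4; congr (u _ _ = v _ _); apply/val_inj.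
- by move: h5; congr (u _ _ = v _ _); apply/val_inj.
- by move: h6; congr (u _ _ = v _ _); apply/val_inj.
Qed.

(** Entries of linear combinations. Rewriting with [mxE] instead would also
    unfold the rows by which the products are defined. *)
Lemma row_entryE n (u : 'rV[R]_n) k :
  (forall v : 'rV[R]_n, (u + v) 0 k = u 0 k + v 0 k) * ((- u) 0 k = - u 0 k) *
  (forall a, (a *: u) 0 k = a * u 0 k).
Proof. by do !split=> *; rewrite mxE. Qed.

Lemma gE u v : g u v = u 0 0 * v 0 0 + u 0 1 * v 0 1 + u 0 2 * v 0 2
  - u 0 3 * v 0 3 - u 0 4 * v 0 4 - u 0 5 * v 0 5 - u 0 6 * v 0 6.
Proof.
rewrite /g !big_ord_recl big_ord0 /= addr0 !addrA.
by do ![congr (_ + _)|congr (- _)|congr (_ * _)]; congr (_ _ _); apply/val_inj.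
Qed.

Lemma qmulE (p q : quat R) :
  (qmul p q 0 0 = p 0 0 * q 0 0 - p 0 1 * q 0 1 - p 0 2 * q 0 2 - p 0 3 * q 0 3)
* (qmul p q 0 1 = p 0 0 * q 0 1 + p 0 1 * q 0 0 + p 0 2 * q 0 3 - p 0 3 * q 0 2)
* (qmul p q 0 2 = p 0 0 * q 0 2 - p 0 1 * q 0 3 + p 0 2 * q 0 0 + p 0 3 * q 0 1)
* (qmul p q 0 3 = p 0 0 * q 0 3 + p 0 1 * q 0 2 - p 0 2 * q 0 1 + p 0 3 * q 0 0).
Proof. by do !split; rewrite mxE. Qed.

Lemma qconjE (q : quat R) :
  (qconj q 0 0 = q 0 0) * (qconj q 0 1 = - q 0 1) *
  (qconj q 0 2 = - q 0 2) * (qconj q 0 3 = - q 0 3).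
Proof. by do !split; rewrite mxE. Qed.

Lemma cayley_of_imagE u :
  ((cayley_of_imag u).1 0 0 = 0) * ((cayley_of_imag u).1 0 1 = u 0 0) *
  ((cayley_of_imag u).1 0 2 = u 0 1) * ((cayley_of_imag u).1 0 3 = u 0 2) *
  ((cayley_of_imag u).2 0 0 = u 0 3) * ((cayley_of_imag u).2 0 1 = u 0 4) *
  ((cayley_of_imag u).2 0 2 = u 0 5) * ((cayley_of_imag u).2 0 3 = u 0 6).
Proof. by do !split; rewrite mxE. Qed.

Lemma ImCaE (z : cayley R) :
  (ImCa z 0 0 = z.1 0 1) * (ImCa z 0 1 = z.1 0 2) * (ImCa z 0 2 = z.1 0 3) *
  (ImCa z 0 3 = z.2 0 0) * (ImCa z 0 4 = z.2 0 1) * (ImCa z 0 5 = z.2 0 2) *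
  (ImCa z 0 6 = z.2 0 3).
Proof. by do !split; rewrite mxE. Qed.

Lemma crossE u v :
  (cross u v 0 0 = u 0 1 * v 0 2 - u 0 2 * v 0 1
     + u 0 4 * v 0 3 - u 0 3 * v 0 4 + u 0 5 * v 0 6 - u 0 6 * v 0 5)
* (cross u v 0 1 = u 0 2 * v 0 0 - u 0 0 * v 0 2
     + u 0 5 * v 0 3 - u 0 3 * v 0 5 + u 0 6 * v 0 4 - u 0 4 * v 0 6)
* (cross u v 0 2 = u 0 0 * v 0 1 - u 0 1 * v 0 0
     + u 0 6 * v 0 3 - u 0 3 * v 0 6 + u 0 4 * v 0 5 - u 0 5 * v 0 4)
* (cross u v 0 3 = u 0 4 * v 0 0 - u 0 0 * v 0 4
     + u 0 5 * v 0 1 - u 0 1 * v 0 5 + u 0 6 * v 0 2 - u 0 2 * v 0 6)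
* (cross u v 0 4 = u 0 0 * v 0 3 - u 0 3 * v 0 0
     + u 0 2 * v 0 5 - u 0 5 * v 0 2 + u 0 6 * v 0 1 - u 0 1 * v 0 6)
* (cross u v 0 5 = u 0 1 * v 0 3 - u 0 3 * v 0 1
     + u 0 4 * v 0 2 - u 0 2 * v 0 4 + u 0 0 * v 0 6 - u 0 6 * v 0 0)
* (cross u v 0 6 = u 0 2 * v 0 3 - u 0 3 * v 0 2
     + u 0 1 * v 0 4 - u 0 4 * v 0 1 + u 0 5 * v 0 0 - u 0 0 * v 0 5).
Proof.
rewrite /cross !ImCaE /cmul /=.
by do !split; rewrite row_entryE !qmulE !qconjE !cayley_of_imagE; ring.
Qed.

Lemma cross_is_bilinear :
  bilinear_for (GRing.Scale.Law.clone _ _ *:%R _)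
    (GRing.Scale.Law.clone _ _ *:%R _) (@cross R : imag R -> imag R -> imag R).
Proof.
by split=> w a u v /=; apply: imag_eqP;
  rewrite !row_entryE !crossE !row_entryE; ring.
Qed.

HB.instance Definition _ := bilinear_isBilinear.Build R
  (imag R) (imag R) (imag R) _ _ (@cross R) cross_is_bilinear.

Lemma g_is_bilinear :
  bilinear_for (GRing.Scale.Law.clone _ _ *:%R _)
    (GRing.Scale.Law.clone _ _ *:%R _) (@g R).
Proof. by split=> [u|u] a x y /=; rewrite ?[g _ u]gC gD gZ // !(gC u). Qed.

HB.instance Definition _ := bilinear_isBilinear.Build R
  (imag R) (imag R) R _ _ (@g R) g_is_bilinear.

Lemma cross_anti u v : cross u v = - cross v u.
Proof. by apply: imag_eqP; rewrite row_entryE !crossE; ring. Qed.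

(** The alternative law of the Cayley algebra gives, for imaginary a and c,
    a * (c * a) = g(a, a) c - g(a, c) a; this is its polarization in a, with
    w * (v * u) rewritten as (u * v) * w. It makes the cross product
    antiassociative on triples of mutually orthogonal vectors. *)
Lemma cross_cross u v w : cross (cross u v) w + cross u (cross v w) =
  (2 * g u w) *: v - g v w *: u - g u v *: w.
Proof.
by rewrite !gE; apply: imag_eqP; rewrite !row_entryE !crossE; ring.
Qed.

Lemma tangent_J x u : tangent x (J x u).
Proof. by rewrite /tangent /= /J /unit_normal gE !crossE; ring. Qed.

(** On tangent vectors this is J J = - 1; the normal part is kept because the
    ambient derivative of a tangent field need not be tangent. *)
Lemma J_J x u : S24 x -> J x (J x u) = g x u *: x - u.
Proof.
move=> Sx; have := cross_cross x x u.
rewrite (Sx : g x x = 1) scale1r mulr_natl mulr2n scalerDl addrK.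
suff -> : cross x x = 0 by rewrite linear0l add0r.
by apply: imag_eqP; rewrite !crossE mxE; ring.
Qed.

(** By [cross_cross], J u * v + J (u * v) = - g(u, v) x, and the right-hand side
    is symmetric in u and v. *)
Lemma cross_J_antisym x u v : tangent x u -> tangent x v ->
  cross (J x u) v - cross (J x v) u = - 2 *: J x (cross u v).
Proof.
move=> xu xv; have := cross_cross x u v; have := cross_cross x v u.
rewrite (xu : g x u = 0) (xv : g x v = 0) [g v u]gC /J /unit_normal.
rewrite mulr0 !scale0r !add0r !subr0 [cross v u]cross_anti linearNr.
move=> /(canRL (subrK _)) -> /(canRL (addrK _)) ->.
by rewrite addrAC opprD addrA subrr add0r -opprD -mulr2n scaleNr scaler_nat.
Qed.

(** * The radial retraction *)

Lemma g_continuous : continuous (fun p : imag R * imag R => g p.1 p.2).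
Proof. exact: bilinear_rV_continuous. Qed.

Lemma cross_continuous : continuous (fun p : imag R * imag R => cross p.1 p.2).
Proof. exact: bilinear_rV_continuous. Qed.

Lemma differentiable_sqnorm x : differentiable (fun y => g y y) x.
Proof. exact: (differentiable_bilinear g_continuous). Qed.

Lemma differentiable_invsqrt (t : R) : 0 < t ->
  differentiable (fun s : R => (Num.sqrt s)^-1) t.
Proof.
move=> t0; apply: differentiableV; last by rewrite gt_eqF// sqrtr_gt0.
by apply/derivable1_diffP; have [] := is_derive1_sqrt t0.
Qed.

Definition inv_norm (y : imag R) : R := (Num.sqrt (g y y))^-1.

Lemma differentiable_inv_norm x : 0 < g x x -> differentiable inv_norm x.
Proof.
move=> gx; apply: (@differentiable_comp _ _ _ _ (fun y => g y y)
  (fun s => (Num.sqrt s)^-1)).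
  exact: differentiable_sqnorm.
exact: differentiable_invsqrt.
Qed.

Lemma differentiable_radial x : 0 < g x x -> differentiable (@radial R) x.
Proof.
move=> gx; apply: (@differentiable_bilinear R _ _ _ _
  (@GRing.scale R (imag R)) inv_norm id).
- exact: scale_continuous.
- exact: differentiable_inv_norm.
- exact: ex_diff.
Qed.

Lemma S24_gt0 x : S24 x -> 0 < g x x.
Proof. by move=> Sx; rewrite (Sx : g x x = 1) ltr01. Qed.

Lemma radial_S24 x : S24 x -> radial x = x.
Proof. by rewrite /S24 /radial /= => ->; rewrite sqrtr1 invr1 scale1r. Qed.

Lemma S24_radial x : 0 < g x x -> S24 (radial x).
Proof.
move=> gx; rewrite /S24 /radial /= gZ gC gZ mulrA -invfM -expr2 sqr_sqrtr ?ltW//.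
by rewrite mulVf// gt_eqF.
Qed.

Lemma near_S24_radial x : S24 x -> \forall y \near x, S24 (radial y).
Proof.
move=> Sx; near=> y; apply: S24_radial; near: y.
have := differentiable_continuous (differentiable_sqnorm x).
by move/(cvgr_gt (g x x)); apply; exact: S24_gt0.
Unshelve. all: by end_near. Qed.

(** The derivative of g(y, y) in a tangent direction vanishes, hence so does
    that of the scaling factor, whatever the derivative of the square root. *)
Lemma is_derive_radial x w : S24 x -> tangent x w ->
  is_derive x w (@radial R) w.
Proof.
move=> Sx xw; have gx := S24_gt0 Sx.
have dn : is_derive x w inv_norm 0.
  apply: DeriveDef; first exact/diff_derivable/differentiable_inv_norm.
  rewrite deriveE; last exact: differentiable_inv_norm.
  rewrite (@diff_comp _ _ _ _ (fun y => g y y) (fun s => (Num.sqrt s)^-1)) /=.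
  - rewrite -(deriveE w (differentiable_sqnorm x)).
    have [_ ->] := is_derive_bilinear g_continuous
      (is_derive_id x w) (is_derive_id x w).
    by rewrite /= [g w x]gC (xw : g x w = 0) addr0 linear0.
  - exact: differentiable_sqnorm.
  - exact: differentiable_invsqrt.
have := @is_derive_bilinear _ _ _ _ _ (@GRing.scale R (imag R)) _ _ _ _ _ _
  (@scale_continuous _ _) dn (is_derive_id x w).
by rewrite /= scale0r add0r /inv_norm (Sx : g x x = 1) sqrtr1 invr1 scale1r.
Qed.

(** * Derivatives of vector fields on the pseudosphere *)

Lemma derivable_vector_field X x w : S24 x -> vector_field X ->
  derivable (X \o @radial R) x w.
Proof.
move=> Sx [+ _] => /(_ x Sx) [U [F [oU Ux sF FX]]].
have dr := differentiable_radial (S24_gt0 Sx).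
apply: (@near_eq_derivable _ _ _ (F \o @radial R)); last first.
  apply/diff_derivable/differentiable_comp; first exact: dr.
  by rewrite radial_S24//; exact: (sF [::]).
have Ur : \forall y \near x, U (radial y).
  apply: (differentiable_continuous dr).
  by rewrite radial_S24//; exact: open_nbhs_nbhs.
near=> y; apply: FX; first by near: y.
by near: y; exact: near_S24_radial.
Unshelve. all: by end_near. Qed.

(** Differentiate g(n, X) = 0 in the direction w: this is the second
    fundamental form of the pseudosphere. *)
Lemma g_derive_vector_field X x w : S24 x -> vector_field X -> tangent x w ->
  g x ('D_w (X \o @radial R) x) = - g w (X x).
Proof.
move=> Sx fX xw; have [_ tX] := fX.
have [_] := is_derive_bilinear g_continuous (is_derive_radial Sx xw)
  (derivableP (derivable_vector_field Sx fX)).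
rewrite (near_eq_derive (g := cst 0)) => [|].
  rewrite derive_cst /= radial_S24// => /esym/eqP.
  by rewrite addrC addr_eq0 => /eqP.
by near=> y; apply: tX; near: y; exact: near_S24_radial.
Unshelve. all: by end_near. Qed.

Lemma derive_Jfield X x w : S24 x -> vector_field X -> tangent x w ->
  'D_w (Jfield X \o @radial R) x = cross w (X x) + J x ('D_w (X \o @radial R) x).
Proof.
move=> Sx fX xw.
have [_ +] := is_derive_bilinear cross_continuous (is_derive_radial Sx xw)
  (derivableP (derivable_vector_field Sx fX)).
by rewrite /= radial_S24.
Qed.

Lemma nijenhuisE X Y x : S24 x -> vector_field X -> vector_field Y ->
  nijenhuis X Y x = - 8 *: J x (cross (X x) (Y x)).
Proof.
move=> Sx fX fY; have xX := fX.2 x Sx; have xY := fY.2 x Sx.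
have at_x Z : (Z \o @radial R) x = Z x by rewrite /= radial_S24.
have JfieldE Z : Jfield Z x = J x (Z x) by [].
rewrite /nijenhuis /lie_bracket /ambient_bracket !at_x !JfieldE.
have xJ w : tangent x (J x w) by exact: tangent_J.
rewrite !derive_Jfield//.
have := g_derive_vector_field Sx fX xY; have := g_derive_vector_field Sx fY xX.
have := cross_J_antisym xX xY.
have JB a b : J x (a - b) = J x a - J x b by exact: linearBr.
have JD a b : J x (a + b) = J x a + J x b by exact: linearDr.
rewrite [g (Y x) (X x)]gC [cross (Y x) (X x)]cross_anti.
(* The derivatives and products are now opaque vectors; generalizing them
   also keeps the rewriting by linearity of J from unfolding them. *)
move: ('D_(J x (X x)) _ x) ('D_(J x (Y x)) _ x) ('D_(X x) _ x) ('D_(Y x) _ x).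
move=> p q r s.
move: (cross (J x (X x)) (Y x)) (cross (J x (Y x)) (X x)) (cross (X x) (Y x)).
move=> a b c ab gr gs.
have JN : J x (- c) = - J x c by exact: linearNr.
rewrite !JB !JD !J_J// gr gs JN.
move: ab => /(canRL (subrK _)) ->.
move: (J x c) (J x p) (J x q) (_ *: x) => d jp jq e.
by apply/rowP => i; rewrite !mxE; ring.
Qed.

End CayleyStructure.

Theorem theorem4p8 (R : realType) (x u v : imag R)
    (Sx : S24 x) (Tu : tangent x u) (Tv : tangent x v)
    (X Y : imag R -> imag R) (fX : vector_field X) (fY : vector_field Y)
    (Xu : X x = u) (Yv : Y x = v) :
  nijenhuis X Y x = - 8 *: cross (unit_normal x) (cross u v) /\
  - 8 *: cross (unit_normal x) (cross u v) = - 8 *: J x (cross u v).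
Proof. by split=> //; rewrite -Xu -Yv; exact: nijenhuisE. Qed.
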